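(* Let $d$ be a nonnegative integer and let $G$ be a group of order $2^{2d+2}$ which contains a central subgroup $E$ isomorphic to $\mathbb{Z}_2^{d+1}$. Let $m\ge 3$ and suppose there exists a $(G/E,m,1)$-difference matrix. Then $G$ contains a reduced linking system of difference sets of size $m-1$, that is, a reduced $\left(2^{2d+2},\,2^d(2^{d+1}-1),\,2^d(2^d-1),\,2^{2d};\,m-1\right)$-linking system of difference sets.
   Context: Groups are written multiplicatively and are not assumed abelian. For a group $G$ of order $v$, a subset $D\subseteq G$ with $k$ elements is a $(v,k,\lambda,n)$-difference set in $G$ if the multiset $\{d_1d_2^{-1} : d_1,d_2\in D,\ d_1\neq d_2\}$ contains every non-identity element of $G$ exactly $\lambda$ times, where $n:=k-\lambda$. A subset $S$ of $G$ is identified with the element $\sum_{s\in S}s$ of the group ring $\mathbb{Z}[G]$, and $S^{(-1)}:=\sum_{s\in S}s^{-1}$. For $\ell\ge 2$, a collection $\{D_1,\dots,D_\ell\}$ of size $\ell$ of $(v,k,\lambda,n)$-difference sets in $G$ is a reduced $(v,k,\lambda,n;\ell)$-linking system of difference sets in $G$ of size $\ell$ if there are integers $\mu,\nu$ such that for all distinct $i,j$ there is some $(v,k,\lambda,n)$-difference set $D(i,j)$ in $G$ (not necessarily one of the $D_r$) with $D_iD_j^{(-1)}=(\mu-\nu)D(i,j)+\nu G$ in $\mathbb{Z}[G]$. For a group $A$ of order $w>1$, an $(A,m,1)$-difference matrix is an $m\times w$ matrix $(b_{i,j})$, $0\le i\le m-1$, $0\le j\le w-1$, with entries in $A$, such that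 for all distinct rows $i$ and $r$ the multiset $\{b_{i,j}b_{r,j}^{-1} : 0\le j\le w-1\}$ contains every element of $A$ exactly once. *)

(* Defs.v *)
From HB Require Import structures.
From mathcomp Require Import all_boot all_order all_algebra all_fingroup.

Set Implicit Arguments.
Unset Strict Implicit.
Unset Printing Implicit Defensive.

Import GRing.Theory.
Local Open Scope ring_scope.

(* The integral group ring Z[gT].  For G : {group gT}, Z[G] is the subring of
   elements supported in G. *)
Definition group_ring (gT : finGroupType) := {ffun gT -> int}.

Section GroupRing.
Variable gT : finGroupType.
Local Notation ZG := (group_ring gT).

HB.instance Definition _ := GRing.Zmodule.on ZG.

Definition gr_elt (g : gT) : ZG := [ffun h => (h == g)%:R].

Definition gr_mul (x y : ZG) : ZG := [ffun g => \sum_h x h * y (h^-1 * g)%g].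

Lemma gr_mulA : associative gr_mul.
Proof.
move=> x y z; apply/ffunP=> g; rewrite !ffunE.
under eq_bigr => h _ do rewrite ffunE big_distrr /=.
under [RHS]eq_bigr => h _ do rewrite ffunE big_distrl /=.
rewrite [RHS]exchange_big /=; apply: eq_bigr => h _.
rewrite [RHS](reindex_inj (mulgI h)) /=; apply: eq_bigr => k _.
by rewrite mulrA mulKg invMg mulgA.
Qed.

Lemma gr_mul1r : left_id (gr_elt 1%g) gr_mul.
Proof.
move=> x; apply/ffunP=> g; rewrite ffunE (bigD1 1%g) //= ffunE eqxx mul1r.
rewrite invg1 mul1g big1 ?addr0 // => h hN1.
by rewrite ffunE (negPf hN1) mul0r.
Qed.

Lemma gr_mulr1 : right_id (gr_elt 1%g) gr_mul.
Proof.
move=> x; apply/ffunP=> g; rewrite ffunE (bigD1 g) //= ffunE mulVg eqxx mulr1.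
rewrite big1 ?addr0 // => h hNg.
by rewrite ffunE -eq_mulVg1 (negPf hNg) mulr0.
Qed.

Lemma gr_mulDl : left_distributive gr_mul +%R.
Proof.
move=> x y z; apply/ffunP=> g; rewrite !ffunE -big_split /=.
by apply: eq_bigr => h _; rewrite ffunE mulrDl.
Qed.

Lemma gr_mulDr : right_distributive gr_mul +%R.
Proof.
move=> x y z; apply/ffunP=> g; rewrite !ffunE -big_split /=.
by apply: eq_bigr => h _; rewrite ffunE mulrDr.
Qed.

Lemma gr_oner_neq0 : gr_elt 1%g != 0.
Proof. by apply/eqP=> /ffunP/(_ 1%g); rewrite !ffunE eqxx. Qed.

HB.instance Definition _ := GRing.Zmodule_isNzRing.Build ZG
  gr_mulA gr_mul1r gr_mulr1 gr_mulDl gr_mulDr gr_oner_neq0.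

Definition gr_set (S : {set gT}) : ZG := \sum_(s in S) gr_elt s.

Definition gr_setV (S : {set gT}) : ZG := \sum_(s in S) gr_elt s^-1%g.

End GroupRing.

Section DifferenceSets.
Variables (gT : finGroupType) (G : {group gT}).

Definition difference_set (v k l n : nat) (D : {set gT}) : Prop :=
  [/\ #|G| = v, D \subset G, #|D| = k, n%:Z = k%:Z - l%:Z
    & forall g, g \in G -> g != 1%g ->
      #|[set p : gT * gT | [&& p.1 \in D, p.2 \in D, p.1 != p.2
                             & (p.1 * p.2^-1)%g == g]]| = l].

(* The collection is a set of subsets, so its members are pairwise distinct. *)
Definition reduced_linking_system (v k l n ell : nat)
    (L : {set {set gT}}) : Prop :=
  [/\ (1 < ell)%N, #|L| = ell, {in L, forall D, difference_set v k l n D}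
    & exists mu nu : int,
      forall Di Dj, Di \in L -> Dj \in L -> Di != Dj ->
      exists2 Dij : {set gT}, difference_set v k l n Dij
        & gr_set Di * gr_setV Dj = gr_set Dij *~ (mu - nu) + gr_set G *~ nu].

End DifferenceSets.

Definition difference_matrix (aT : finGroupType) (A : {group aT}) (m : nat)
    (b : 'M[aT]_(m, #|A|)) : Prop :=
  [/\ (1 < #|A|)%N, forall i j, b i j \in A
    & forall i r, i != r ->
      forall a, a \in A -> #|[set j | (b i j * (b r j)^-1)%g == a]| = 1%N].

(* Main.v *)
Require Import Defs.
From mathcomp Require Import all_boot all_order all_algebra all_fingroup all_solvable.
From mathcomp Require Import zify.

Set Implicit Arguments.
Unset Strict Implicit.
Unset Printing Implicit Defensive.

(** The difference sets are read off from +-1 functions on G.  Write U for the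
    space of (d+1)-bit vectors, identify E with U, and let X_u in Z[E] be the
    sum of the values of the character (-1)^(u.e) over e in E.  Orthogonality
    of characters says that X_u X_v = 0 for u != v, that X_u X_u = |E| X_u and
    that the X_u add up to |E| times the identity.

    Given a family a : U -> G that meets every coset of E exactly once, put
    B_a = sum_u a_u X_u (the element bent a).  On the coset a_u E it is the
    translate of a character, so it takes the values 1 and -1 only, and
    D_a = { g | B_a g = -1 } (bent_set a) satisfies 2 D_a = G - B_a.  As E is
    central, the orthogonality relations give
        B_a B_b^* = |E| B_(a b^-1)   (bent_mul),
    where * extends inversion and a b^-1 is the pointwise quotient.  For b = a
    this is |G| times the identity, whence D_a is a difference set with the
    stated parameters (bent_set_difference_set).  If a b^-1 meets every coset
    of E exactly once as well, expanding (G - B_a)(G - B_b^* ) shows that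
    4 D_a D_b^* is a combination of D_(a b^-1) and G (bent_set_linked), which
    is the linking identity.

    Finally a difference matrix over G/E with m rows supplies m - 1 such
    families: divide each row entrywise by the last one and lift the entries
    to G.  The defining property, applied to a row and the last row, makes each
    lift meet every coset once; applied to two other rows, it does so for their
    quotient, from which the last row cancels.  Labelling the columns by U uses
    that |G/E| = |E|. *)

(** * The integral group ring *)

Section GroupRingFacts.

Import GRing.Theory.
Local Open Scope ring_scope.

Variable gT : finGroupType.
Implicit Types (x y : group_ring gT) (A : {set gT}) (G : {group gT}) (g : gT).

(** The anti-involution of Z[G] extending inversion; it takes S to S^(-1). *)
Definition gr_adj x : group_ring gT := [ffun g => x g^-1%g].

Definition gr_aug x : int := \sum_g x g.

Lemma gr_mulE x y g : (x * y) g = \sum_h x h * y (h^-1 * g)%g.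
Proof. exact: ffunE. Qed.

Lemma gr_mul_eltl g x h : (gr_elt g * x) h = x (g^-1 * h)%g.
Proof.
rewrite gr_mulE (bigD1 g) //= ffunE eqxx mul1r big1 ?addr0 // => k kNg.
by rewrite ffunE (negPf kNg) mul0r.
Qed.

Lemma gr_mul_eltr x g h : (x * gr_elt g) h = x (h * g^-1)%g.
Proof.
rewrite gr_mulE (bigD1 (h * g^-1)%g) //= ffunE invMg invgK mulgKV eqxx mulr1.
rewrite big1 ?addr0 // => k kN; rewrite ffunE.
case: eqP => [eg|]; last by rewrite mulr0.
by case/eqP: kN; rewrite -eg invMg invgK mulKVg.
Qed.

Lemma gr_elt_mul g h : gr_elt g * gr_elt h = gr_elt (g * h)%g.
Proof.
apply/ffunP=> k; rewrite gr_mul_eltl !ffunE.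
by rewrite -(inj_eq (mulgI g)) mulKVg.
Qed.

Lemma gr_sumE (I : finType) (P : pred I) (F : I -> group_ring gT) g :
  (\sum_(i | P i) F i) g = \sum_(i | P i) F i g.
Proof. exact: sum_ffunE. Qed.

Lemma gr_setE A g : gr_set A g = (g \in A)%:R.
Proof.
rewrite gr_sumE; case: (boolP (g \in A)) => [gA|gNA].
  rewrite (bigD1 g) //= ffunE eqxx big1 ?addr0 // => h /andP[_ hNg].
  by rewrite ffunE eq_sym (negPf hNg).
rewrite big1 // => h hA; rewrite ffunE; case: eqP => // eg.
by rewrite eg hA in gNA.
Qed.

Lemma gr_setV_adj A : gr_setV A = gr_adj (gr_set A).
Proof.
apply/ffunP=> g; rewrite !ffunE !gr_sumE; apply: eq_bigr => h _.
by rewrite !ffunE (can2_eq invgK invgK).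
Qed.

Lemma gr_adjD x y : gr_adj (x + y) = gr_adj x + gr_adj y.
Proof. by apply/ffunP=> g; rewrite !ffunE. Qed.

Lemma gr_adj_sum (I : finType) (F : I -> group_ring gT) :
  gr_adj (\sum_i F i) = \sum_i gr_adj (F i).
Proof.
apply/ffunP=> g; rewrite ffunE !gr_sumE.
by apply: eq_bigr => i _; rewrite ffunE.
Qed.

Lemma gr_adj_eltl g x : gr_adj (gr_elt g * x) = gr_adj x * gr_elt g^-1%g.
Proof.
apply/ffunP=> h.
by rewrite ffunE gr_mul_eltl gr_mul_eltr ffunE invMg !invgK.
Qed.

Lemma gr_aug_adj x : gr_aug (gr_adj x) = gr_aug x.
Proof.
rewrite /gr_aug [RHS](reindex_inj invg_inj) /=.
by apply: eq_bigr => g _; rewrite ffunE.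
Qed.

(** The product sees the whole ambient group type, so membership in the subring
    Z[G] has to be recorded separately. *)
Definition gr_supp G x := forall g, g \notin G -> x g = 0.

Lemma gr_supp_adj G x : gr_supp G x -> gr_supp G (gr_adj x).
Proof. by move=> Gx g gNG; rewrite ffunE Gx ?groupV. Qed.

Lemma gr_supp_set G A : A \subset G -> gr_supp G (gr_set A).
Proof.
move=> sAG g gNG; rewrite gr_setE; case: (boolP (g \in A)) => // /(subsetP sAG).
by rewrite (negPf gNG).
Qed.

Lemma gr_mul_setr G x : gr_supp G x -> x * gr_set G = gr_set G *~ gr_aug x.
Proof.
move=> Gx; apply/ffunP=> g; rewrite gr_mulE ffunMzE gr_setE mulrzz.
rewrite /gr_aug mulr_sumr; apply: eq_bigr => h _; rewrite gr_setE mulrC.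
case: (boolP (h \in G)) => hG; last by rewrite Gx ?mulr0.
by rewrite groupMl ?groupV.
Qed.

Lemma gr_mul_setl G x : gr_supp G x -> gr_set G * x = gr_set G *~ gr_aug x.
Proof.
move=> Gx; apply/ffunP=> g; rewrite gr_mulE ffunMzE gr_setE mulrzz.
rewrite /gr_aug mulr_sumr (reindex_inj (mulgI g)) /=.
rewrite [RHS](reindex_inj invg_inj) /=; apply: eq_bigr => h _.
rewrite gr_setE invMg mulgKV.
case: (boolP (h \in G)) => hG; last by rewrite Gx ?groupV ?mulr0.
by rewrite groupMr.
Qed.

Lemma gr_augD x y : gr_aug (x + y) = gr_aug x + gr_aug y.
Proof.
by rewrite /gr_aug -big_split; apply: eq_bigr => g _; rewrite !ffunE.
Qed.

Lemma gr_augB x y : gr_aug (x - y) = gr_aug x - gr_aug y.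
Proof. by rewrite /gr_aug -sumrB; apply: eq_bigr => g _; rewrite !ffunE. Qed.

Lemma gr_aug_set A : gr_aug (gr_set A) = #|A|%:Z.
Proof.
rewrite /gr_aug -sum1_card -natz natr_sum [RHS]big_mkcond.
apply: eq_bigr => g _.
by rewrite gr_setE; case: (g \in A).
Qed.

(** The pairs are counted by their first entry h, the second being g^-1 h; the
    two entries differ because g is not the identity. *)
Lemma gr_mul_set_adj A g : g != 1%g ->
  (gr_set A * gr_setV A) g =
  #|[set p : gT * gT | [&& p.1 \in A, p.2 \in A, p.1 != p.2
                         & (p.1 * p.2^-1)%g == g]]|%:Z.
Proof.
move=> gN1; set S := [set p | _].
have -> : S = [set (h, (g^-1 * h)%g)
                 | h in [set h | (h \in A) && ((g^-1 * h)%g \in A)]].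
  apply/setP=> -[h k]; rewrite inE /=.
  apply/and4P/imsetP => [[hA kA _ /eqP eg]|].
    have ek : (g^-1 * h)%g = k by rewrite -eg invMg invgK mulgKV.
    by exists h; rewrite ?inE ?ek ?hA.
  case=> x; rewrite inE => /andP[xA yA] [-> ->]; split=> //.
    by rewrite -[eqbLHS]mul1g (inj_eq (mulIg x)) eq_sym invg_eq1.
  by rewrite invMg invgK mulKVg.
rewrite card_imset => [|h k []] //.
rewrite gr_mulE gr_setV_adj -sum1_card -natz natr_sum.
rewrite [RHS]big_mkcond /=; apply: eq_bigr => h _.
rewrite !gr_setE ffunE gr_setE invMg invgK inE.
by case: (h \in A); case: (_ \in A).
Qed.

End GroupRingFacts.

(** * Characters of the space of binary vectors *)

Section Characters.

Import GRing.Theory.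
Local Open Scope ring_scope.

Variable n : nat.
Implicit Types u v : 'rV['Z_2]_n.

Definition bin_char u v : int := (-1) ^+ nat_of_ord ((u *m v^T) 0 0).

Lemma bin_charC u v : bin_char u v = bin_char v u.
Proof. by rewrite /bin_char -(trmxK (u *m v^T)) mxE trmx_mul trmxK. Qed.

Lemma bin_charDr u v1 v2 :
  bin_char u (v1 + v2) = bin_char u v1 * bin_char u v2.
Proof.
rewrite /bin_char linearD mulmxDr mxE -exprD.
by move: ((u *m v1^T) 0 0) ((u *m v2^T) 0 0) => [[|[|?]] ?] [[|[|?]] ?].
Qed.

Lemma bin_charDl u1 u2 v :
  bin_char (u1 + u2) v = bin_char u1 v * bin_char u2 v.
Proof. by rewrite !(bin_charC _ v) bin_charDr. Qed.

Lemma bin_char0r u : bin_char u 0 = 1.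
Proof. by rewrite /bin_char trmx0 mulmx0 mxE. Qed.

Lemma bin_char0l v : bin_char 0 v = 1.
Proof. by rewrite bin_charC bin_char0r. Qed.

Lemma bin_char_cases u v : bin_char u v = 1 \/ bin_char u v = -1.
Proof.
by rewrite /bin_char; move: ((u *m v^T) 0 0) => [[|[|?]] ?]; [left|right|].
Qed.

Lemma bin_charNr u v : bin_char u (- v) = bin_char u v.
Proof.
have: bin_char u (- v) * bin_char u v = 1.
  by rewrite -bin_charDr addNr bin_char0r.
by case: (bin_char_cases u v) => ->; case: (bin_char_cases u (- v)) => ->.
Qed.

(** For u != 0 some unit vector w has character value -1, and translating the
    summation variable by w changes the sign of the sum.  The form u.v being
    symmetric, this also gives the sum over all characters at a fixed v. *)
Lemma sum_bin_char u :
  \sum_v bin_char u v = (u == 0)%:R * #|{: 'rV['Z_2]_n}|%:R.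
Proof.
case: eqP => [->|/eqP uN0].
  rewrite mul1r -sum1_card natr_sum.
  by apply: eq_bigr => v _; rewrite bin_char0l.
have [i ui] : exists i, u 0 i != 0.
  apply/existsP; apply: contraR uN0; rewrite negb_exists => /forallP u0.
  by apply/eqP/rowP=> i; rewrite mxE; apply/eqP; rewrite -[_ == _]negbK.
pose w : 'rV['Z_2]_n := delta_mx 0 i.
have uw : bin_char u w = -1.
  rewrite /bin_char trmx_delta -colE mxE; move: ui.
  by move: (u 0 i) => [[|[|?]] ?].
set S := \sum_v _; suff: S = - S by lia.
rewrite {1}/S (reindex_inj (addrI w)) /= -sumrN.
by apply: eq_bigr => v _; rewrite bin_charDr uw mulN1r.
Qed.

End Characters.

(** * Character sums and the difference sets they define *)

Section CharacterSums.

Import GRing.Theory.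
Local Open Scope ring_scope.

Variables (n : nat) (gT : finGroupType) (E : {group gT}).
Local Notation U := 'rV['Z_2]_n.
Variable f : {morphism E >-> U}.
Hypotheses (injf : ('injm f)%g) (imf : (f @* E)%g = [set: U]%g).
Implicit Types (u v : U) (e g : gT).

Definition char_sum u : group_ring gT :=
  [ffun e => if e \in E then bin_char u (f e) else 0].

(* The group law on U is addition; these restate the morphism property of f in
   the ring notation in which the characters are handled. *)
Lemma morph_addE e1 e2 : e1 \in E -> e2 \in E -> f (e1 * e2)%g = f e1 + f e2.
Proof. exact: morphM. Qed.

Lemma morph_oppE e : e \in E -> f e^-1%g = - f e.
Proof. exact: morphV. Qed.

Lemma sum_injm (F : U -> int) : \sum_(e in E) F (f e) = \sum_v F v.
Proof.
rewrite -(big_imset F (injmP injf)) /=; apply: eq_bigl => v.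
have := in_setT v; rewrite -imf morphimEdom => ->; exact: erefl.
Qed.

Lemma card_E : #|E| = #|{: U}|.
Proof. by rewrite -(card_injm injf) // imf cardsT. Qed.

Lemma char_sum_aug u : gr_aug (char_sum u) = (u == 0)%:R * #|E|%:Z.
Proof.
rewrite card_E -natz -sum_bin_char -sum_injm [RHS]big_mkcond.
by apply: eq_bigr => e _; rewrite ffunE.
Qed.

(** The coefficient at g is a convolution of two characters: it is the value
    of the second one at g times the sum of the quotient of the two. *)
Lemma char_sum_mul u v :
  char_sum u * char_sum v = char_sum u *~ ((u == v)%:R * #|E|%:Z).
Proof.
apply/ffunP=> g; rewrite gr_mulE ffunMzE.
case: (boolP (g \in E)) => gE; last first.
  rewrite [in RHS]ffunE (negPf gE) mul0rz big1 // => h _; rewrite !ffunE.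
  case: ifP => hE; last by rewrite mul0r.
  by rewrite groupMl ?groupV // (negPf gE) mulr0.
transitivity (bin_char v (f g) * \sum_(e in E) bin_char (u - v) (f e)).
  rewrite mulr_sumr [RHS]big_mkcond; apply: eq_bigr => h _; rewrite !ffunE.
  case: ifP => hE; last by rewrite mul0r.
  rewrite groupMl ?groupV // gE morph_addE ?groupV // morph_oppE //.
  rewrite bin_charDr bin_charDl bin_charNr.
  have -> : bin_char (- v) (f h) = bin_char v (f h).
    by rewrite bin_charC bin_charNr bin_charC.
  by rewrite mulrA mulrC.
rewrite (sum_injm (bin_char (u - v))) sum_bin_char subr_eq0 -card_E.
rewrite ffunE gE mulrzz -[#|E|%:Z]natz.
by case: eqP => [->|_]; rewrite ?mul0r ?mulr0.
Qed.

Lemma sum_char_sum : \sum_u char_sum u = 1 *~ #|E|%:Z.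
Proof.
apply/ffunP=> g; rewrite gr_sumE ffunMzE [(1 : group_ring gT) g]ffunE.
transitivity (\sum_u (if g \in E then bin_char u (f g) else 0)).
  by apply: eq_bigr => u _; rewrite ffunE.
case: (boolP (g \in E)) => gE; last first.
  rewrite big1 //; case: eqP => [eg|_]; last by rewrite mul0rz.
  by rewrite eg group1 in gE.
under eq_bigr do rewrite bin_charC.
rewrite sum_bin_char -card_E mulrzz -[#|E|%:Z]natz.
have -> //: (f g == 0) = (g == 1%g).
by rewrite -(inj_in_eq (injmP injf) gE (group1 E)) morph1.
Qed.

Lemma char_sum_adj u : gr_adj (char_sum u) = char_sum u.
Proof.
apply/ffunP=> g; rewrite !ffunE groupV.
by case: ifP => gE //; rewrite morph_oppE // bin_charNr.
Qed.

Variable G : {group gT}.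
Hypothesis centE : E \subset 'Z(G)%g.
Implicit Types (a b : U -> gT).

Lemma sub_center_G : E \subset G.
Proof. exact: subset_trans centE (center_sub G). Qed.

Lemma cent_E e g : e \in E -> g \in G -> (e * g = g * e)%g.
Proof. by move=> /(subsetP centE) /setIP[_ /centP cGe] /cGe. Qed.

Lemma norm_E g : g \in G -> g \in 'N(E)%g.
Proof.
move: g; apply/subsetP; apply: subset_trans (cent_sub E).
by rewrite centsC (subset_trans centE) ?subsetIr.
Qed.

Lemma char_sum_comm u g :
  g \in G -> char_sum u * gr_elt g = gr_elt g * char_sum u.
Proof.
move=> gG; apply/ffunP=> h; rewrite gr_mul_eltr gr_mul_eltl !ffunE.
rewrite -mem_rcoset -mem_lcoset norm_rlcoset ?norm_E //.
case: ifP => //; rewrite mem_lcoset => hE; congr (bin_char u (f _)).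
by rewrite -{1}(mulKVg g h) -(cent_E hE gG) mulgK.
Qed.

(** With one a u in each coset of E this is the +-1 function of
    a McFarland difference set: gr_elt (a u) * char_sum u lives on the coset
    a u * E, where the character indexed by u splits it by a translated
    hyperplane; the index 0 leaves its coset entirely positive. *)
Definition bent a : group_ring gT := \sum_u gr_elt (a u) * char_sum u.

Definition div_map a b : U -> gT := fun u => (a u * (b u)^-1)%g.

Definition bent_set a : {set gT} := [set g in G | bent a g == -1].

Definition transversal_map a :=
  (forall u, a u \in G) /\
  (forall x, x \in (G / E)%g -> #|[set u | coset E (a u) == x]| = 1%N).

(** Cross terms vanish by orthogonality, and the diagonal terms combine because
    the sums X_u commute with G. *)
Lemma bent_mul a b : (forall u, a u \in G) -> (forall u, b u \in G) ->
  bent a * gr_adj (bent b) = bent (div_map a b) *~ #|E|%:Z.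
Proof.
move=> aG bG; rewrite gr_adj_sum mulr_suml mulrz_suml; apply: eq_bigr => u _.
rewrite mulr_sumr (bigD1 u) //= big1 => [|v vNu].
  rewrite addr0 gr_adj_eltl char_sum_adj mulrA -(mulrA (gr_elt _)) char_sum_mul.
  rewrite eqxx mul1r mulrzAr mulrzAl -mulrA char_sum_comm ?groupV //.
  by rewrite mulrA gr_elt_mul.
rewrite gr_adj_eltl char_sum_adj mulrA -(mulrA (gr_elt _)) char_sum_mul.
by rewrite eq_sym (negPf vNu) mul0r mulr0z mulr0 mul0r.
Qed.

Lemma bent_one : bent (fun=> 1%g) = 1 *~ #|E|%:Z.
Proof.
by rewrite -sum_char_sum; apply: eq_bigr => u _; rewrite mul1r.
Qed.

Lemma bent_out a g : (forall u, a u \in G) -> g \notin G -> bent a g = 0.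
Proof.
move=> aG gNG; rewrite gr_sumE big1 // => u _; rewrite gr_mul_eltl ffunE.
case: ifP => // /(subsetP sub_center_G).
by rewrite groupMl ?groupV // (negPf gNG).
Qed.

(** Only the index of the coset containing g contributes. *)
Lemma bent_cases a g : transversal_map a -> g \in G ->
  bent a g = 1 \/ bent a g = -1.
Proof.
case=> aG aT gG; have /eqP/cards1P[u0 eu0] := aT _ (mem_quotient E gG).
have Eu u : (((a u)^-1 * g)%g \in E) = (u == u0).
  have := in_set1 u u0; rewrite -eu0 inE => <-.
  rewrite -mem_lcoset -norm_rlcoset ?norm_E // eq_sym.
  exact/(sameP (rcoset_kercosetP (norm_E gG) (norm_E (aG u)))) /eqP.
rewrite gr_sumE (bigD1 u0) //= big1 => [|u uN].
  by rewrite addr0 gr_mul_eltl ffunE Eu eqxx; apply: bin_char_cases.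
by rewrite gr_mul_eltl ffunE Eu (negPf uN).
Qed.

(** Translation preserves the coefficient sum, and nontrivial characters sum
    to 0. *)
Lemma bent_aug a : gr_aug (bent a) = #|E|%:Z.
Proof.
transitivity (\sum_u gr_aug (char_sum u)).
  rewrite /gr_aug; under eq_bigr do rewrite gr_sumE.
  rewrite exchange_big /=; apply: eq_bigr => u _.
  rewrite (reindex_inj (mulgI (a u))) /=.
  by apply: eq_bigr => g _; rewrite gr_mul_eltl mulKg.
rewrite (bigD1 0) //= big1 => [|u uN0]; rewrite char_sum_aug.
  by rewrite eqxx mul1r addr0.
by rewrite (negPf uN0) mul0r.
Qed.

Lemma bent_setE a : transversal_map a ->
  gr_set (bent_set a) *+ 2 = gr_set G - bent a.
Proof.
move=> aT; apply/ffunP=> g; rewrite !ffunE !gr_setE inE.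
case: (boolP (g \in G)) => gG; last by rewrite (bent_out (proj1 aT)).
by case: (bent_cases aT gG) => ->.
Qed.

Lemma gr_adj_group : gr_adj (gr_set G) = gr_set G.
Proof. by apply/ffunP=> g; rewrite ffunE !gr_setE groupV. Qed.

(** Since 2 D_a = G - B_a and 2 D_b^* = G - B_b^* , this expands the product
    of the two; multiplying by G only retains coefficient sums. *)
Lemma bent_set_mul a b : transversal_map a -> transversal_map b ->
  (gr_set (bent_set a) * gr_setV (bent_set b)) *+ 4 =
  gr_set G *~ (#|G|%:Z - #|E|%:Z *+ 2) + bent a * gr_adj (bent b).
Proof.
move=> aT bT; have supp c : transversal_map c -> gr_supp G (bent c).
  by move=> [cG _] g; apply: bent_out.
have eb : gr_setV (bent_set b) *+ 2 = gr_set G - gr_adj (bent b).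
  have := congr1 (@gr_adj gT) (bent_setE bT).
  rewrite !gr_adjD -gr_setV_adj mulr2n => ->.
  by rewrite gr_adj_group; congr (_ + _); apply/ffunP=> g; rewrite !ffunE.
rewrite (mulrnA _ 2 2) -mulrnAr -mulrnAl eb (bent_setE aT).
rewrite mulrBl !mulrBr gr_mul_setr; last exact: gr_supp_set.
rewrite gr_aug_set gr_mul_setl ?gr_mul_setr; try exact: supp.
  rewrite gr_aug_adj !bent_aug mulrzBr mulr2n mulrzDr.
  by rewrite opprB opprD !addrA -!addrA; congr (_ + (_ + _)); rewrite addrC.
exact/gr_supp_adj/supp.
Qed.

(* In the application q = 2 ^ d. *)
Section SquareOrder.

Variable q : nat.
Hypotheses (cardE : #|E| = (2 * q)%N) (cardG : #|G| = (4 * q ^ 2)%N).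

Lemma bent_self a : transversal_map a ->
  bent a * gr_adj (bent a) = 1 *~ #|G|%:Z.
Proof.
move=> [aG _]; rewrite bent_mul //.
have -> : bent (div_map a a) = bent (fun=> 1%g).
  by apply: eq_bigr => u _; rewrite /div_map mulgV.
rewrite bent_one -mulrzA; congr (_ *~ _); lia.
Qed.

(** The size of D_a comes from the coefficient sum of B_a, and the number of
    representations of g != 1 from the coefficient at g of D_a D_a^* , to which
    B_a B_a^* = |G| does not contribute. *)
Lemma bent_set_difference_set a : transversal_map a ->
  difference_set G (4 * q ^ 2) (q * (2 * q - 1)) (q * (q - 1)) (q ^ 2)
    (bent_set a).
Proof.
move=> aT; have q0 : (0 < q)%N by have := cardG_gt0 E; lia.
split=> //.
- by apply/subsetP=> g; rewrite inE => /andP[].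
- have := congr1 (@gr_aug gT) (bent_setE aT).
  rewrite gr_augB mulr2n gr_augD bent_aug !gr_aug_set cardE cardG; nia.
- nia.
move=> g gG gN1; apply/eqP; rewrite -eqz_nat -gr_mul_set_adj //; apply/eqP.
have := congr1 (fun x : group_ring gT => x g) (bent_set_mul aT aT).
rewrite bent_self // ffunMnE !ffunE !ffunMzE gr_setE gG ffunE (negPf gN1).
rewrite mul0rz addr0 cardE cardG -mulrzl mulr1; nia.
Qed.

(** Multiplied by 4, the identity is bent_set_mul.  Dividing by 4 requires q to
    be even, that is d > 0; the integrality of the coefficient at 1, read
    modulo 4, forces this. *)
Lemma bent_set_linked a b : transversal_map a -> transversal_map b ->
  transversal_map (div_map a b) ->
  gr_set (bent_set a) * gr_setV (bent_set b) =
    gr_set (bent_set (div_map a b)) *~ (- q%:Z) + gr_set G *~ (q ^ 2 - q./2)%N%:Z.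
Proof.
set c := div_map a b => aT bT cT.
have bentab : bent a * gr_adj (bent b) =
    (gr_set G - gr_set (bent_set c) *+ 2) *~ #|E|%:Z.
  rewrite bent_setE // opprB addrC subrK.
  exact: bent_mul (proj1 aT) (proj1 bT).
have coef g : (gr_set (bent_set a) * gr_setV (bent_set b)) g * 4 =
    (g \in G)%:R * (4 * q%:Z ^+ 2 - 2 * q%:Z)
    - (g \in bent_set c)%:R * (4 * q%:Z).
  have := congr1 (fun x : group_ring gT => x g) (bent_set_mul aT bT).
  rewrite bentab ffunMnE mulr_natr => ->.
  rewrite ffunE !ffunMzE !ffunE !gr_setE cardE cardG !mulrzz.
  case: (g \in G); case: (g \in bent_set c); lia.
have q_even : ~~ odd q.
  have := coef 1%g; rewrite group1; case: (1%g \in bent_set c); lia.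
apply/ffunP=> g; rewrite [RHS]ffunE !ffunMzE !gr_setE !mulrzz; move: (coef g).
have -> : (q ^ 2 - q./2)%N%:Z = q%:Z ^+ 2 - (q./2)%:Z.
  by rewrite -subzn //; nia.
have eq2: q = (q./2).*2 by rewrite -[LHS]odd_double_half (negPf q_even).
move: (_ g) (q./2) eq2 => x h eq2; rewrite !eq2.
case: (g \in G); case: (g \in bent_set c); lia.
Qed.

(** If D_a = D_b then B_a = B_b, so the coefficient of B_a B_b^* at 1 is |G|;
    but it is also |E| times +1 or -1. *)
Lemma bent_set_neq a b : transversal_map a -> transversal_map b ->
  transversal_map (div_map a b) -> (1 < #|E|)%N ->
  bent_set a != bent_set b.
Proof.
move=> aT bT cT E1; apply/eqP=> eD.
have eB : bent a = bent b.
  by apply: oppr_inj; apply: (addrI (gr_set G)); rewrite -!bent_setE // eD.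
have := bent_mul (proj1 aT) (proj1 bT); rewrite -eB bent_self //.
move/(congr1 (fun x : group_ring gT => x 1%g)); rewrite /= !ffunMzE.
rewrite ffunE eqxx !mulrzz.
move: E1; rewrite cardE cardG mul1r => E1.
by case: (bent_cases cT (group1 G)) => ->; rewrite ?mul1r ?mulN1r; nia.
Qed.

End SquareOrder.

End CharacterSums.

(** * Transversals from a difference matrix *)

Section TransversalsFromMatrix.

Import GRing.Theory.

Variables (n : nat) (gT : finGroupType) (G E : {group gT}) (m : nat).
Local Notation U := 'rV['Z_2]_n.
Variable b : 'M[coset_of E]_(m.+1, #|(G / E)%G|).
Hypotheses (nEG : (E <| G)%g) (bP : difference_matrix b).
Hypothesis cardU : #|{: U}| = #|(G / E)%G|.

Definition mx_col (u : U) : 'I_#|(G / E)%G| := cast_ord cardU (enum_rank u).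

Lemma card_mx_col (P : pred 'I_#|(G / E)%G|) :
  #|[set u | P (mx_col u)]| = #|[set j | P j]|.
Proof.
have mx_colI : injective mx_col.
  by apply: inj_comp; [apply: cast_ord_inj | apply: enum_rank_inj].
rewrite -(card_imset _ mx_colI); apply: eq_card => j; rewrite inE.
apply/imsetP/idP => [[u /[!inE] Pu ->] // | Pj].
have jK : mx_col (enum_val (cast_ord (esym cardU) j)) = j.
  by rewrite /mx_col enum_valK cast_ordKV.
by exists (enum_val (cast_ord (esym cardU) j)); rewrite ?inE jK.
Qed.

(** The difference property of two rows i and r, transported from the columns
    to U. *)
Lemma rows_transversal (a : U -> gT) i r : i != r ->
  (forall u, a u \in G) ->
  (forall u, coset E (a u) = b i (mx_col u) * (b r (mx_col u))^-1)%g ->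
  transversal_map E G a.
Proof.
have [_ _ bD] := bP => iNr aG ea; split=> // x xA.
apply: etrans (bD _ _ iNr x xA).
rewrite -(card_mx_col (fun j => b i j * (b r j)^-1 == x)%g).
by apply: eq_card => u; rewrite !inE ea.
Qed.

(** Dividing by the last row replaces the usual normalisation that makes that
    row constant; it leaves the quotients of two rows unchanged. *)
Definition row_lift (i : 'I_m.+1) (u : U) : gT :=
  repr (b i (mx_col u) * (b ord_max (mx_col u))^-1)%g.

Lemma row_lift_coset i u :
  coset E (row_lift i u) = (b i (mx_col u) * (b ord_max (mx_col u))^-1)%g.
Proof. exact: coset_reprK. Qed.

Lemma mem_row_lift i u : row_lift i u \in G.
Proof.
have [_ bA _] := bP.
rewrite -(quotientGK nEG) mem_morphpre ?repr_coset_norm //.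
by rewrite [coset_morphism E _]row_lift_coset groupM ?groupV ?bA.
Qed.

Lemma row_lift_transversal i : i != ord_max -> transversal_map E G (row_lift i).
Proof.
move=> iN; apply: (rows_transversal iN); first exact: mem_row_lift.
exact: row_lift_coset.
Qed.

Lemma row_lift_div_transversal i r : i != r ->
  transversal_map E G (div_map (row_lift i) (row_lift r)).
Proof.
move=> iNr; apply: (rows_transversal iNr) => u.
  by rewrite groupM ?groupV ?mem_row_lift.
have nE j : row_lift j u \in 'N(E)%g.
  exact: subsetP (normal_norm nEG) _ (mem_row_lift j u).
rewrite morphM ?groupV // morphV //= !row_lift_coset.
by rewrite invMg invgK mulgA mulgKV.
Qed.

End TransversalsFromMatrix.

(** * Linking systems *)

Theorem theorem5p6 (d : nat) (gT : finGroupType) (G E : {group gT}) (m : nat)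
    (cardG : #|G| = 2 ^ (2 * d + 2))
    (centralE : E \subset 'Z(G)%g)
    (isoE : (E \isog [set: 'rV['Z_2]_d.+1])%g)
    (hm : 3 <= m)
    (hb : exists b : 'M[coset_of E]_(m, #|(G / E)%G|),
        difference_matrix (A := (G / E)%G) b) :
  exists L : {set {set gT}},
    reduced_linking_system G (2 ^ (2 * d + 2)) (2 ^ d * (2 ^ d.+1 - 1))
      (2 ^ d * (2 ^ d - 1)) (2 ^ (2 * d)) (m - 1) L.
Proof.
case: m hm hb => [//|m] hm [b bP]; rewrite (subn1 m.+1) /=.
have [f injf imf] := isogP isoE.
set q := 2 ^ d.
have q2 : 2 ^ d.+1 = 2 * q by rewrite expnS.
have q4 : 2 ^ (2 * d + 2) = 4 * q ^ 2 by rewrite expnD mulnC [2 * d]mulnC expnM.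
have qq : 2 ^ (2 * d) = q ^ 2 by rewrite mulnC expnM.
have cardE : #|E| = 2 * q.
  by rewrite (card_E injf imf) card_mx mul1n card_ord q2.
rewrite q4 in cardG *; rewrite q2 qq.
have q0 : 0 < q by rewrite expn_gt0.
have nEG : (E <| G)%g by apply: sub_center_normal.
have cardU : #|{: 'rV['Z_2]_d.+1}| = #|(G / E)%G|.
  rewrite -(card_E injf imf) card_quotient ?normal_norm //.
  have := Lagrange (normal_sub nEG); rewrite cardE cardG => eL.
  have : q * (2 * q) = q * #|G : E|%g by nia.
  by move/eqP; rewrite eqn_pmul2l // => /eqP.
pose a := row_lift b cardU.
have aT i : i != ord_max -> transversal_map E G (a i).
  exact: row_lift_transversal.
have acT i r : i != r -> transversal_map E G (div_map (a i) (a r)).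
  exact: row_lift_div_transversal.
pose D i := bent_set f G (a i).
have DN i r : i != ord_max -> r != ord_max -> i != r -> D i != D r.
  move=> iN rN iNr.
  have acT' := acT _ _ iNr.
  apply: (bent_set_neq injf imf centralE cardE cardG _ _ acT') => //.
  - exact: aT.
  - exact: aT.
  - by rewrite cardE; lia.
exists [set D i | i in [set~ ord_max]]; split.
- by lia.
- rewrite card_in_imset ?cardsC1 ?card_ord // => i r; rewrite !inE => iN rN.
  by case: (eqVneq i r) => // iNr /eqP; rewrite (negPf (DN _ _ iN rN iNr)).
- move=> _ /imsetP[i /[!inE] iN ->].
  exact: (bent_set_difference_set injf imf centralE cardE cardG (aT _ iN)).
(* mu = nu - q, with nu the coefficient of G in bent_set_linked. *)
exists (GRing.add (Posz (q ^ 2 - q./2)) (GRing.opp (Posz q))).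
exists (Posz (q ^ 2 - q./2)).
move=> _ _ /imsetP[i /[!inE] iN ->] /imsetP[r /[!inE] rN ->] DNir.
have iNr : i != r by apply: contraNneq DNir => ->.
exists (bent_set f G (div_map (a i) (a r))).
  exact: (bent_set_difference_set injf imf centralE cardE cardG (acT _ _ iNr)).
have lnk := bent_set_linked injf imf centralE cardE cardG (aT _ iN) (aT _ rN).
rewrite (lnk (acT _ _ iNr)).
rewrite [GRing.add _ (GRing.opp (Posz (_ - _)))]GRing.addrAC.
by rewrite GRing.subrr GRing.add0r.
Qed.
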